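(* For any integer $k\geq 1$ there exist a finite abelian group $G$ and a generating set $B\subseteq G$ such that the Cayley graph $\mathrm{Cay}(G,B)$ has undirected diameter at most $2$, contains a directed cycle, and the length of its shortest directed cycle is at least $k$.
   Context: For a finite group $G$ (written additively when abelian) and a generating set $B\subseteq G$, the Cayley graph $\mathrm{Cay}(G,B)$ is the directed graph with vertex set $G$ in which there is a directed edge from $x$ to $y$ if and only if $y=x+g$ for some $g\in B$. The undirected diameter of a directed graph is the maximum distance between two vertices when edge orientations are ignored. A directed cycle of length $\ell\geq1$ is a closed path of $\ell$ edges respecting edge orientations (a loop is a directed cycle of length 1). *)

(* Defs.v *)
From mathcomp Require Import all_boot all_fingroup.

Set Implicit Arguments.
Unset Strict Implicit.
Unset Printing Implicit Defensive.

Definition cayley (gT : finGroupType) (B : {set gT}) : rel gT :=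
  fun x y => [exists g in B, y == (x * g)%g].

Definition undirected (T : finType) (e : rel T) : rel T :=
  fun x y => e x y || e y x.

Definition walk_of_length (T : finType) (e : rel T) (x y : T) (n : nat) : Prop :=
  exists p : seq T, [/\ path e x p, last x p = y & size p = n].

(* No n satisfies [is_distance e x y n] when y is not reachable from x. *)
Definition is_distance (T : finType) (e : rel T) (x y : T) (n : nat) : Prop :=
  walk_of_length e x y n /\ (forall m, walk_of_length e x y m -> n <= m).

(* The diameter is the maximum distance; a disconnected graph has none. *)
Definition is_diameter (T : finType) (e : rel T) (d : nat) : Prop :=
  (forall x y, exists2 n, is_distance e x y n & n <= d)
  /\ (exists x y, is_distance e x y d).

Definition is_undirected_diameter (T : finType) (e : rel T) (d : nat) : Prop :=
  is_diameter (undirected e) d.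

(* The cycle is given by its cyclic list of vertices, so [size c] is also its
   number of edges; [path.cycle e [:: x]] is the loop [e x x].  Vertices may repeat,
   which does not affect the length of a shortest cycle.  The size condition is
   needed because [path.cycle e [::]] holds. *)
Definition directed_cycle (T : finType) (e : rel T) (c : seq T) : Prop :=
  0 < size c /\ path.cycle e c.

Definition shortest_directed_cycle (T : finType) (e : rel T) (c : seq T) : Prop :=
  directed_cycle e c /\ (forall c', directed_cycle e c' -> size c <= size c').

(* Main.v *)
Require Import Defs.
From mathcomp Require Import all_boot all_fingroup.
From mathcomp Require Import all_algebra.

(** A difference cover in the style of Haight.  For f : G -> G put
    B = {f n} ∪ {f n + n}.  Every g in G is a difference (f g + g) - f g, so
    B generates G and the undirected diameter is at most 2.  Closed walks of
    length m in the Cayley graph are zero sums of m elements of B, so f has to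
    be chosen such that there are none with 0 < m < k.  Take G = F^N with F a
    field whose characteristic is at least k, and build f so that every zero
    sum with fewer than k terms involves at least l distinct parameters n; the
    case l = k is absurd.  To pass from l to l + 1, replace F^N by F^N x F^W
    with W the set of all weights w : F^N -> F, and f by
    (x, y) |-> (f x, (1 - w(x) y_w)_w).  In a zero sum of the new set, the
    projections to F^N take at least l values; if there are only l parameters
    (x, y), then y is a function of x.  Choosing w(x) to be the proportion,
    among the terms lying over x, of those of the form f n + n cancels all
    the y-terms in coordinate w, which leaves m = 0 in F. *)

(** Let [w] be the mean of [e] on each fibre of [x]. As [y] is constant there, it factors out, and
    deviations from the mean sum to zero. A nonempty fibre has at most [size s] terms, so its size
    is invertible in [F]. *)
Lemma fibrewise_mean (F : fieldType) (X : finType) (I : eqType)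
    (s : seq I) (x : I -> X) (e : I -> F) :
  (forall n, 0 < n <= size s -> (n%:R != 0 :> F)%R) ->
  exists w : {ffun X -> F}, forall y : I -> F,
    {in s &, forall i j, x i = x j -> y i = y j} ->
    (\sum_(i <- s) (e i - w (x i)) * y i = 0)%R.
Proof.
move=> size_nz; pose c a := count (fun i => x i == a) s.
exists [ffun a => ((\sum_(i <- s | x i == a) e i) / (c a)%:R)%R] => y y_of_x.
rewrite (partition_big x xpredT) //=; apply: big1 => a _.
have [c0|c_gt0] := posnP (c a).
  by rewrite big_hasC // has_count -/(c a) c0.
have /hasP[i0 si0 /eqP xi0] : has (fun i => x i == a) s by rewrite has_count.
under eq_bigr => i /eqP -> do rewrite ffunE.
set w := (_ / _)%R.
have -> : (\sum_(i <- s | x i == a) (e i - w) * y i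
           = \sum_(i <- s | x i == a) (e i - w) * y i0)%R.
  rewrite big_seq_cond [RHS]big_seq_cond; apply: eq_bigr => i /andP[si /eqP xi].
  by rewrite (y_of_x i i0) // xi xi0.
rewrite -GRing.mulr_suml GRing.sumrB big_const_seq GRing.iter_addr GRing.addr0 -/(c a).
rewrite -GRing.mulr_natr GRing.mulfVK ?GRing.subrr ?GRing.mul0r //.
by apply: size_nz; rewrite c_gt0 count_size.
Qed.

(** The flag [t.2] selects the kind of term: [f n] if false, [f n + n] if true, where [n = t.1]. *)
Lemma zero_sums_many_parameters (F : finFieldType) (k l : nat) :
  (forall n, 0 < n < k -> (n%:R != 0 :> F)%R) ->
  exists N (f : 'rV[F]_N -> 'rV[F]_N), forall s : seq ('rV[F]_N * bool),
    0 < size s < k -> (\sum_(t <- s) (f t.1 + t.1 *+ t.2) = 0)%R ->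
    l <= #|[set n in map fst s]|.
Proof.
move=> char_ge; elim: l => [|l [N [f IH]]].
  by exists 0, id.
pose W := {ffun 'rV[F]_N -> F}.
pose y (n : 'rV[F]_(N + #|W|)) (w : W) := rsubmx n ord0 (enum_rank w).
pose g (n : 'rV[F]_(N + #|W|)) : 'rV[F]_(N + #|W|) :=
  row_mx (f (lsubmx n)) (\row_j (1 - (enum_val j : W) (lsubmx n) * rsubmx n ord0 j))%R.
exists (N + #|W|), g => s size_s sum0; rewrite ltnNge; apply/negP => few.
have [_ size_lt] := andP size_s.
set P := [set n in map fst s] in few.
(* The projected sum is a zero sum for [f], so it has at least [l] parameters by induction; [P] has
   at most [l], so projecting merges none. *)
have lsub_inj : {in P &, injective (@lsubmx F 1 N #|W|)}.
  apply/imset_injP; rewrite eqn_leq leq_imset_card (leq_trans few) //.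
  pose s' := [seq (lsubmx t.1, t.2) | t <- s].
  have -> : [set lsubmx x | x in P] = [set n in map fst s'].
    apply/setP => a; rewrite inE -map_comp; apply/imsetP/mapP.
      by case=> n; rewrite inE => /mapP[t st ->] ->; exists t.
    by case=> t st ->; exists t.1 => //; rewrite inE map_f.
  apply: IH; first by rewrite size_map.
  rewrite big_map /= -[RHS](GRing.linear0 (@lsubmx F 1 N #|W|)) -sum0 GRing.linear_sum.
  by apply: eq_bigr => t _; rewrite GRing.linearD GRing.linearMn /= row_mxKl.
have in_P t : t \in s -> t.1 \in P by move=> st; rewrite inE map_f.
have [|w w_mean] := fibrewise_mean F _ _ s (fun t => lsubmx t.1) (fun t => t.2%:R%R).
  by move=> n /andP[n_gt0 n_le]; rewrite char_ge // n_gt0 (leq_ltn_trans n_le).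
have {w_mean}sum_w0 := w_mean (fun t => y t.1 w).
have {}sum_w0 : (\sum_(t <- s) (t.2%:R - w (lsubmx t.1)) * y t.1 w = 0)%R.
  by apply: sum_w0 => t u st su /lsub_inj tu; rewrite tu ?in_P.
(* Coordinate [w] of the zero sum is [size s] plus the vanishing sum [sum_w0], which forces [size s]
   to be zero in [F]. *)
have := char_ge _ size_s; case/eqP.
have <- : (\sum_(t <- s) (1 : F) = (size s)%:R)%R.
  by rewrite big_const_seq count_predT GRing.iter_addr_0.
rewrite -[LHS]GRing.addr0 -[X in (_ + X)%R]sum_w0 -big_split /=.
transitivity (rsubmx (\sum_(t <- s) (g t.1 + t.1 *+ t.2)) ord0 (enum_rank w))%R.
  rewrite GRing.linear_sum summxE; apply: eq_bigr => t _.
  rewrite GRing.linearD GRing.linearMn /= row_mxKr /y !mxE enum_rankK mulmxnE !mxE.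
  by rewrite GRing.mulrBl GRing.mulr_natl GRing.addrA GRing.addrAC.
by rewrite sum0 GRing.linear0 mxE.
Qed.

(** Distances are least walk lengths, and their maximum is attained since [T] is finite and contains
    [x0]. *)
Lemma diameter_exists_le (T : finType) (e : rel T) (x0 : T) (D : nat) :
  (forall x y, exists2 n, walk_of_length e x y n & n <= D) ->
  exists2 d, is_diameter e d & d <= D.
Proof.
move=> walks.
pose walkb x y n := [exists p : n.-tuple T, path e x p && (last x p == y)].
have walkP x y n : reflect (walk_of_length e x y n) (walkb x y n).
  apply: (iffP existsP) => [[p /andP[xp /eqP py]]|[p [xp py sz]]].
    by exists p; rewrite size_tuple.
  by move/eqP: sz => sz; exists (Tuple sz); rewrite /= xp py eqxx.
have ex_walkb x y : exists n, walkb x y n.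
  by have [n /walkP] := walks x y; exists n.
pose dist x y := ex_minn (ex_walkb x y).
have distP x y : is_distance e x y (dist x y).
  rewrite /dist; case: ex_minnP => n /walkP xy n_min.
  by split=> // m /walkP /n_min.
have dist_le x y : dist x y <= D.
  by have [n xy /(leq_trans _)->] := walks x y; last exact: (distP x y).2.
have [|[x y] /= dE] := eq_bigmax (fun p : T * T => dist p.1 p.2).
  by apply/card_gt0P; exists (x0, x0).
exists (dist x y) => //; split; last by exists x, y; apply: distP.
move=> u v; exists (dist u v); first exact: distP.
by rewrite -dE; apply: (leq_bigmax (u, v)).
Qed.

Lemma cayley_path_prod (gT : finGroupType) (B : {set gT}) (x : gT) (p : seq gT) :
  path (cayley B) x p -> exists s : seq gT,
    [/\ size s = size p, {subset s <= B} & last x p = (x * \prod_(g <- s) g)%g].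
Proof.
elim: p x => [|y p IH] x /=; first by exists [::]; rewrite big_nil mulg1.
case/andP=> /exists_inP[g Bg /eqP->] /IH[s [sz sB ->]]; exists (g :: s).
split; rewrite /= ?sz ?big_cons ?mulgA // => h.
by rewrite inE => /predU1P[->|/sB].
Qed.

Lemma cayley_cycle_prod (gT : finGroupType) (B : {set gT}) (c : seq gT) :
  directed_cycle (cayley B) c -> exists s : seq gT,
    [/\ size s = size c, {subset s <= B} & (\prod_(g <- s) g = 1)%g].
Proof.
case: c => [[]//|x p] [_ /cayley_path_prod[s [sz sB]]].
rewrite size_rcons last_rcons in sz * => /eqP.
by rewrite -[X in X == _]mulg1 (inj_eq (mulgI x)) eq_sym => /eqP s1; exists s.
Qed.

Lemma cayley_has_directed_cycle (gT : finGroupType) (B : {set gT}) (b : gT) :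
  b \in B -> exists c : seq gT, directed_cycle (cayley B) c.
Proof.
(* The cycle runs through the powers of [b]. *)
move=> Bb; exists (fingraph.orbit (fun x => x * b)%g 1%g); split.
  by rewrite size_orbit fingraph.order_gt0.
have /(_ 1%g) := cycle_orbit (mulIg b); apply: sub_cycle => x _ /eqP <-.
by apply/exists_inP; exists b.
Qed.

Lemma difference_cover_gen (gT : finGroupType) (B : {set gT}) :
  (forall g, exists b c, [/\ b \in B, c \in B & g = b * c^-1]%g) ->
  <<B>>%g = [set: gT].
Proof.
move=> cover; apply/eqP; rewrite eqEsubset subsetT; apply/subsetP => g _.
by have [b [c [Bb Bc ->]]] := cover g; rewrite groupM ?groupV ?mem_gen.
Qed.

(** Writing [x^-1 * y = b * c^-1] gives [x * b = y * c], a common out-neighbour of [x] and [y]. *)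
Lemma difference_cover_walk (gT : finGroupType) (B : {set gT}) :
  (forall g, exists b c, [/\ b \in B, c \in B & g = b * c^-1]%g) ->
  forall x y, walk_of_length (undirected (cayley B)) x y 2.
Proof.
move=> cover x y; have [b [c [Bb Bc bc]]] := cover (x^-1 * y)%g.
have yE : (y * c = x * b)%g.
  by rewrite -[y in LHS](mulKVg x) bc -mulgA mulgKV.
exists [:: (x * b)%g; y]; split=> //=; rewrite andbT; apply/andP; split.
  by apply/orP; left; apply/exists_inP; exists b.
by apply/orP; right; apply/exists_inP; exists c; rewrite ?yE.
Qed.

Theorem proposition5p3 (k : nat) (hk : 1 <= k) :
  exists (gT : finGroupType) (B : {set gT}),
    [/\ abelian [set: gT],
        <<B>>%g = [set: gT],
        exists2 d : nat, is_undirected_diameter (cayley B) d & d <= 2,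
        exists c : seq gT, directed_cycle (cayley B) c
      & forall c : seq gT, shortest_directed_cycle (cayley B) c -> k <= size c].
Proof.
have [q k_lt_q q_pr] := prime_above k.
have char_ge n : 0 < n < k -> (n%:R != 0 :> 'F_q)%R.
  case/andP=> n_gt0 n_lt; rewrite -(GRing.dvdn_pcharf (pchar_Fp q_pr)).
  by rewrite gtnNdvd // (ltn_trans n_lt).
have [N [f zero_sums]] := zero_sums_many_parameters _ k k char_ge.
pose b (t : 'rV['F_q]_N * bool) := (f t.1 + t.1 *+ t.2)%R.
pose B := [set b t | t in setT].
have B_b t : b t \in B by apply: imset_f.
have cover (g : 'rV['F_q]_N) :
    exists b c, [/\ b \in B, c \in B & g = b * c^-1]%g.
  exists (b (g, true)), (b (g, false)); split=> //.
  rewrite FinRing.zmodMgE FinRing.zmodVgE /b /= GRing.addr0 GRing.addrAC.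
  by rewrite GRing.subrr GRing.add0r.
exists 'rV['F_q]_N, B; split.
- exact: FinRing.zmod_abelian.
- exact: difference_cover_gen.
- apply: (diameter_exists_le _ _ (0%R : 'rV['F_q]_N)) => x y.
  by exists 2 => //; apply: difference_cover_walk.
- exact: (cayley_has_directed_cycle _ _ _ (B_b (0%R, true))).
move=> c [c_cycle _]; rewrite leqNgt; apply/negP => c_lt.
have [s [sz sB s1]] := cayley_cycle_prod _ _ _ c_cycle.
have [s' s'E] : exists s', s = map b s'.
  elim: s sB {sz s1} => [|g s IH] sB; first by exists [::].
  have [|s' ->] := IH; first by move=> h sh; apply: sB; rewrite inE sh orbT.
  have /imsetP[t _ ->] := sB g (mem_head _ _).
  by exists (t :: s').
have size_s' : 0 < size s' < k.
  by move: sz; rewrite s'E size_map => ->; rewrite c_lt andbT; case: c_cycle.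
(* Fewer than [k] terms cannot involve [k] distinct parameters. *)
have : k <= #|[set n in map fst s']|.
  by apply: zero_sums => //; move: s1; rewrite s'E big_map.
apply/negP; rewrite -ltnNge cardsE (leq_ltn_trans (card_size _)) //.
by rewrite size_map; case/andP: size_s'.
Qed.
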